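(* Let $A$ and $B$ be $C^*$-ternary algebras with norms $\|\cdot\|_A$ and $\|\cdot\|_B$. Let $p<1$ and $\theta$ be nonnegative real numbers, and let $f:A\to B$ be a mapping such that $$\left\|f\left(\tfrac{x_2-x_1}{3}\right)+f\left(\tfrac{x_1-3\mu x_3}{3}\right)+\mu f\left(\tfrac{3x_1+3x_3-x_2}{3}\right)-f(x_1)\right\|_B\le\theta\left(\|x_1\|_A^p+\|x_2\|_A^p+\|x_3\|_A^p\right)$$ and $$\left\|f([x_1,x_2,x_3])-[f(x_1),f(x_2),f(x_3)]\right\|_B\le\theta\left(\|x_1\|_A^{3p}+\|x_2\|_A^{3p}+\|x_3\|_A^{3p}\right)$$ for all $\mu\in\mathbb{T}^1=\{\lambda\in\mathbb{C}:|\lambda|=1\}$ and all $x_1,x_2,x_3\in A$. Then there exists a unique $C^*$-ternary algebra homomorphism $H:A\to B$ such that $$\|H(x_1)-f(x_1)\|_B\le\frac{\theta(1+2^p)\|x_1\|_A^p}{3^{1-p}-1}$$ for all $x_1\in A$.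
   Context: A $C^*$-ternary algebra is a complex Banach space $A$ equipped with a ternary product $(x,y,z)\mapsto[x,y,z]$ from $A^3$ into $A$ which is $\mathbb{C}$-linear in the outer variables, conjugate $\mathbb{C}$-linear in the middle variable, associative in the sense that $[x,y,[z,w,v]]=[x,[w,z,y],v]=[[x,y,z],w,v]$, and satisfies $\|[x,y,z]\|\le\|x\|\,\|y\|\,\|z\|$ and $\|[x,x,x]\|=\|x\|^3$. A $C^*$-ternary algebra homomorphism is a $\mathbb{C}$-linear mapping $H:A\to B$ between $C^*$-ternary algebras such that $H([x,y,z])=[H(x),H(y),H(z)]$ for all $x,y,z\in A$.
   Formalization: When p = 0, the power ‖0‖^p is read as 0; with 0^0 = 1 the claim fails for a small constant map f = c with ‖c‖ = 3θ/2. For p > 0 nothing is changed. *)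

(* Defs.v *)
From HB Require Import structures.
From mathcomp Require Import all_boot all_order all_algebra.
From mathcomp Require Import all_classical all_reals all_analysis.
From mathcomp Require Export complex.
Import Order.TTheory GRing.Theory Num.Theory.
Import numFieldNormedType.Exports.

Set Implicit Arguments.
Unset Strict Implicit.
Unset Printing Implicit Defensive.

Local Open Scope ring_scope.

HB.mixin Record CompleteNormedModule_isCStarTernary (R : realType) (A : Type)
    of CompleteNormedModule R[i] A := {
  tprod : A -> A -> A -> A;
  tprod_linearl : forall y z : A, linear (fun x => tprod x y z);
  tprod_conj_linear : forall (a : R[i]) (x y y' z : A),
    tprod x (a *: y + y') z = a^* *: tprod x y z + tprod x y' z;
  tprod_linearr : forall x y : A, linear (fun z => tprod x y z);
  tprodA_mid : forall x y z w v : A,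
    tprod x y (tprod z w v) = tprod x (tprod w z y) v;
  tprodA : forall x y z w v : A,
    tprod x (tprod w z y) v = tprod (tprod x y z) w v;
  norm_tprod_le : forall x y z : A, `|tprod x y z| <= `|x| * `|y| * `|z|;
  norm_tprod_cube : forall x : A, `|tprod x x x| = `|x| ^+ 3
}.

#[short(type="cstarTernaryType")]
HB.structure Definition CStarTernary (R : realType) :=
  {A of CompleteNormedModule_isCStarTernary R A & CompleteNormedModule R[i] A}.

Definition cstar_ternary_hom (R : realType) (A B : cstarTernaryType R)
    (H : A -> B) : Prop :=
  linear H /\ forall x y z : A, H (tprod x y z) = tprod (H x) (H y) (H z).

(* The norm of a normed module over R[i] takes its values in R[i], among the
   nonnegative real elements; [rnorm] is that same norm with values in R. *)
Definition rnorm (R : realType) (V : normedModType R[i]) (x : V) : R :=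
  complex.Re `|x|.

(* ||x||^s, with 0^s = 0 for every s >= 0, including s = 0. This differs from
   [powR] only at s = 0, where [powR] has 0 `^ 0 = 1. With that other convention
   the stability bound fails for exponent 0: a constant map f = c with
   ||c|| = 3 theta / 2 small satisfies both hypotheses, but f - H is not bounded
   by theta at 0. The factor 1 + 2^p in that bound is
   ||x||^p + ||2 x||^p + ||0||^p with ||0||^p = 0. *)
Definition norm_pow (R : realType) (V : normedModType R[i]) (x : V) (s : R) : R :=
  if x == 0 then 0 else rnorm x `^ s.

(* Main.v *)
(* Putting x2 = 2 x1, x3 = 0, mu = 1 in the first inequality gives
   |3 f(x/3) - f(x)| <= theta (1 + 2^p) |x|^p, so the direct method applies:
   the sequence 3^-n f(3^n x) is Cauchy, with steps decaying like r^n where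
   r = 3^(p-1) < 1, and H x is its limit.  The defects in both inequalities,
   once rescaled, are O(r^n) and hence vanish for H.  The limit
   functional equation makes H additive and homogeneous for scalars in the unit
   circle; every complex number being a natural multiple of a sum of two unit
   ones, H is linear. *)
Require Import Defs.
From HB Require Import structures.
From mathcomp Require Import all_boot all_order all_algebra.
From mathcomp Require Import all_classical all_reals all_analysis.
From mathcomp Require Import ring lra.
Import Order.TTheory GRing.Theory Num.Theory.
Import numFieldNormedType.Exports.
Local Open Scope ring_scope.

Set Implicit Arguments.
Unset Strict Implicit.
Unset Printing Implicit Defensive.

(** * Real-valued norms and their powers *)

Section RealNorm.
Variables (R : realType) (V : normedModType R[i]).
Implicit Types (x y z : V) (a : R[i]) (c : R).

Lemma normE x : `|x| = ((rnorm x)%:C)%C.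
Proof. by rewrite /rnorm RRe_real // ger0_real. Qed.

Lemma rnorm_ge0 x : 0 <= rnorm x.
Proof. by rewrite -ler0c -normE. Qed.

Lemma rnorm0 : rnorm (0 : V) = 0.
Proof. by rewrite /rnorm normr0. Qed.

Lemma rnorm_le0 x : rnorm x <= 0 -> x = 0.
Proof. by move=> h; apply/eqP; rewrite -normr_le0 normE lecR. Qed.

Lemma rnormN x : rnorm (- x) = rnorm x.
Proof. by rewrite /rnorm normrN. Qed.

Lemma rnormD x y : rnorm (x + y) <= rnorm x + rnorm y.
Proof. by rewrite -lecR rmorphD /= -!normE ler_normD. Qed.

Lemma rdistC x y : rnorm (x - y) = rnorm (y - x).
Proof. by rewrite -rnormN opprB. Qed.

Lemma rdistD z x y : rnorm (x - y) <= rnorm (x - z) + rnorm (z - y).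
Proof. by have := rnormD (x - z) (z - y); rewrite addrA subrK. Qed.

Lemma rnormZ a c x : `|a| = (c%:C)%C -> rnorm (a *: x) = c * rnorm x.
Proof.
by move=> ac; apply: complexI; rewrite rmorphM /= -!normE -ac normrZ.
Qed.

Lemma norm_pow_ge0 x c : 0 <= norm_pow x c.
Proof. by rewrite /norm_pow; case: ifP => // _; exact: powR_ge0. Qed.

Lemma norm_pow0 c : norm_pow (0 : V) c = 0.
Proof. by rewrite /norm_pow eqxx. Qed.

Lemma norm_powZ a c x s : 0 < c -> `|a| = (c%:C)%C ->
  norm_pow (a *: x) s = c `^ s * norm_pow x s.
Proof.
move=> c0 ac; have a0 : a != 0 by rewrite -normr_gt0 ac ltcR.
rewrite /norm_pow scaler_eq0 (negPf a0) /=; case: ifP => _; first by rewrite mulr0.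
by rewrite (rnormZ _ ac) powRM ?rnorm_ge0// ltW.
Qed.

End RealNorm.

Lemma norm_natX (R : realType) (m n : nat) :
  `|m%:R ^+ n : R[i]| = (((m%:R ^+ n : R))%:C)%C.
Proof. by rewrite normrX normr_nat rmorphXn rmorph_nat. Qed.

Lemma norm_natXV (R : realType) (m n : nat) :
  `|m%:R ^- n : R[i]| = (((m%:R ^- n : R))%:C)%C.
Proof. by rewrite normfV norm_natX fmorphV. Qed.

Lemma geometric_small (R : realType) (r C e : R) :
  0 <= r < 1 -> 0 < e -> exists n, C * r ^+ n < e.
Proof.
move=> /andP[r0 r1] e0.
have /(cvg_geometric C) : `|r| < 1 by rewrite ger0_norm.
move=> /cvgr0_norm_lt/(_ _ e0)[n _ /(_ n (leqnn n)) /= Cn].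
by exists n; apply: le_lt_trans Cn; exact: ler_norm.
Qed.

(** * From unit scalars to all complex scalars *)

(** A real [t] in (0, 2] is the sum of the conjugate points [t / 2] ± i [s] of the unit circle,
    where [s] is real because [t <= 2]. Rotating both by [z / |z|] handles a general nonzero [z]. *)
Lemma unit_circle_sum (R : realType) (z : R[i]) : `|z| <= 2 ->
  exists m1 m2, [/\ `|m1| = 1, `|m2| = 1 & z = m1 + m2].
Proof.
move=> z2; have [->|z0] := eqVneq z 0.
  by exists 1, (-1); rewrite normrN normr1 subrr.
have nz : (0 : R[i]) < `|z| by rewrite normr_gt0.
have [t zt] : exists t, `|z| = (t%:C)%C.
  by apply/complex_realP; rewrite ger0_real.
have t2 : t <= 2 by rewrite -lecR -zt rmorph_nat.
have t0 : 0 < t by rewrite -ltcR -zt.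
pose s := Num.sqrt (1 - (t / 2) ^+ 2).
have ss : s ^+ 2 = 1 - (t / 2) ^+ 2 by rewrite sqr_sqrtr//; nra.
pose w := (t / 2 +i* s)%C; pose w' := (t / 2 -i* s)%C.
have w1 : `|w| = 1.
  by rewrite normc_def /= ss [X in Num.sqrt X](_ : _ = 1) ?sqrtr1//; ring.
have w'1 : `|w'| = 1.
  by rewrite normc_def /= sqrrN ss [X in Num.sqrt X](_ : _ = 1) ?sqrtr1//; ring.
have uu : `|z / `|z| | = 1 by rewrite normrM normfV normr_id divff// gt_eqF.
exists (z / `|z| * w), (z / `|z| * w'); split.
- by rewrite normrM uu w1 mulr1.
- by rewrite normrM uu w'1 mulr1.
- rewrite -mulrDr (_ : w + w' = `|z|) ?divfK ?gt_eqF// zt.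
  by rewrite /w /w'; apply/eqP; rewrite eq_complex /= subrr -splitr !eqxx.
Qed.

Lemma linear_of_unit_circle (R : realType) (U V : lmodType R[i]) (H : U -> V) :
  (forall x y, H (x + y) = H x + H y) ->
  (forall (m : R[i]) x, `|m| = 1 -> H (m *: x) = m *: H x) -> linear H.
Proof.
move=> HD Hm a x y; rewrite HD; congr (_ + _).
have HMn (u : U) n : H (u *+ n.+1) = H u *+ n.+1.
  by elim: n => // n ih; rewrite mulrS HD ih -mulrS.
have [c ac] : exists c, `|a| = (c%:C)%C.
  by apply/complex_realP; rewrite ger0_real.
have c0 : 0 <= c by rewrite -ler0c -ac.
(* Dividing [a] by a natural number above its modulus brings it into the disc where it splits into
   two unit scalars; additivity of [H] restores the multiple. *)
set n := Num.bound c; have cn : c < n.+1%:R.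
  by apply: lt_le_trans (archi_boundP c0) _; rewrite ler_nat.
have n0 : n.+1%:R != 0 :> R[i] by [].
have [|m1 [m2 [m11 m21 am]]] := @unit_circle_sum R (a / n.+1%:R).
  rewrite normrM normfV normr_nat ac -(rmorph_nat (real_complex R)) -fmorphV.
  rewrite -(rmorph_nat (real_complex R) 2) -rmorphM /= lecR ler_pdivrMr//.
  by rewrite mulr_natl mulr2n; move: cn c0; lra.
have {1}-> : a *: x = (m1 *: x + m2 *: x) *+ n.+1.
  by rewrite -scalerDl -am -scaler_nat scalerA mulrC divfK.
rewrite HMn HD !Hm// -scalerDl -am -scaler_nat scalerA.
by rewrite mulrC divfK.
Qed.

(** * Convergence at a geometric rate *)

(** The rate [r] is fixed while the constant is existential, so that limits can be combined
    algebraically with no epsilon management. *)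
Definition geo_cvg (R : realType) (V : normedModType R[i]) (r : R)
    (u : nat -> V) (l : V) :=
  exists C, forall n, rnorm (u n - l) <= C * r ^+ n.

Section GeometricConvergence.
Variables (R : realType) (V : normedModType R[i]) (r : R).
Hypothesis r01 : 0 <= r < 1.
Implicit Types (u v : nat -> V) (l m : V) (C : R).

Let r_ge0 : 0 <= r. Proof. by case/andP: r01. Qed.
Let r_lt1 : r < 1. Proof. by case/andP: r01. Qed.
Let rX_ge0 n : 0 <= r ^+ n. Proof. exact: exprn_ge0. Qed.

Lemma geo_small_eq0 C l : (forall n, rnorm l <= C * r ^+ n) -> l = 0.
Proof.
move=> lC; apply: rnorm_le0; rewrite leNgt; apply/negP => l0.
by have [n /(le_lt_trans (lC n))] := geometric_small C r01 l0; rewrite ltxx.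
Qed.

Lemma geo_cvg_unique u l m : geo_cvg r u l -> geo_cvg r u m -> l = m.
Proof.
move=> [C uC] [D uD]; apply/eqP; rewrite -subr_eq0; apply/eqP.
apply: (@geo_small_eq0 (C + D)) => n; rewrite mulrDl.
apply: le_trans (rdistD (u n) l m) _.
by rewrite lerD// rdistC.
Qed.

Lemma geo_cvg_perturb u v l C : geo_cvg r u l ->
  (forall n, rnorm (v n - u n) <= C * r ^+ n) -> geo_cvg r v l.
Proof.
move=> [D uD] vu; exists (C + D) => n; rewrite mulrDl.
by apply: le_trans (rdistD (u n) (v n) l) _; exact: lerD.
Qed.

Lemma geo_cvgD u v l m : geo_cvg r u l -> geo_cvg r v m ->
  geo_cvg r (fun n => u n + v n) (l + m).
Proof.
move=> [C uC] [D vD]; exists (C + D) => n; rewrite mulrDl.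
have -> : u n + v n - (l + m) = (u n - l) + (v n - m) by rewrite opprD addrACA.
by apply: le_trans (rnormD _ _) _; exact: lerD.
Qed.

Lemma geo_cvgZ (a : R[i]) u l : geo_cvg r u l ->
  geo_cvg r (fun n => a *: u n) (a *: l).
Proof.
move=> [C uC]; have [c ac] : exists c, `|a| = (c%:C)%C.
  by apply/complex_realP; rewrite ger0_real.
exists (c * C) => n; rewrite -scalerBr (rnormZ _ ac) -mulrA ler_wpM2l//.
by rewrite -ler0c -ac.
Qed.

Lemma geo_cvgB u v l m : geo_cvg r u l -> geo_cvg r v m ->
  geo_cvg r (fun n => u n - v n) (l - m).
Proof.
move=> ul vm; have := geo_cvgD ul (geo_cvgZ (-1) vm).
by rewrite scaleN1r; under eq_fun do rewrite scaleN1r.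
Qed.

Lemma geo_cvg_bounded u l : geo_cvg r u l ->
  exists2 M, 0 <= M & forall n, rnorm (u n) <= M.
Proof.
move=> [C uC]; have C0 : 0 <= C.
  by have := le_trans (rnorm_ge0 _) (uC 0); rewrite expr0 mulr1.
exists (C + rnorm l) => [|n]; first by rewrite addr_ge0 ?rnorm_ge0.
have := rnormD (u n - l) l; rewrite subrK => /le_trans; apply.
rewrite lerD2r (le_trans (uC n))// ler_piMr// exprn_ile1// ltW//.
Qed.

End GeometricConvergence.

(** The factor [1 - r] makes the steps sum to exactly [C * r ^+ n]; at [n = 0] this yields the
    constant of the stability bound. *)
Lemma geo_cauchy_cvg (R : realType) (V : completeNormedModType R[i]) (r C : R)
    (u : nat -> V) : 0 <= r < 1 ->
  (forall n, rnorm (u n - u n.+1) <= C * (1 - r) * r ^+ n) ->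
  exists l, forall n, rnorm (u n - l) <= C * r ^+ n.
Proof.
move=> r01 step; have /andP[r0 r1] := r01.
have C0 : 0 <= C.
  have := le_trans (rnorm_ge0 _) (step 0).
  by rewrite expr0 mulr1 pmulr_lge0// subr_gt0.
have near n k : rnorm (u n - u (n + k)%N) <= C * r ^+ n.
  (* The telescoped bound is the one that passes through the induction on [k]. *)
  suff : rnorm (u n - u (n + k)%N) <= C * (r ^+ n - r ^+ (n + k)).
    move=> /le_trans; apply; rewrite ler_wpM2l// lerBlDr lerDl.
    exact: exprn_ge0.
  elim: k => [|k ih]; first by rewrite addn0 !subrr rnorm0 mulr0.
  apply: le_trans (rdistD (u (n + k)%N) _ _) _; rewrite addnS.
  apply: le_trans (lerD ih (step _)) _; rewrite exprS -mulrA -mulrDr.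
  by rewrite le_eqVlt; apply/orP; left; apply/eqP; ring.
have : cvg (u n @[n --> \oo])%classic.
  apply/cauchy_cvgP/cauchy_exP => e e0.
  have [c ec] : exists c, e = (c%:C)%C.
    by apply/complex_realP; rewrite gtr0_real.
  have c0 : 0 < c by rewrite -ltcR -ec.
  have [n nc] := geometric_small C r01 c0.
  exists (u n); exists n => // k /= nk; rewrite -ball_normE /= normE ec ltcR.
  by rewrite -(subnKC nk); exact: le_lt_trans (near n _) nc.
(* The bound [near], uniform in [k], passes to the limit: some late term lies within [e] of [l]. *)
move=> /cvg_ex[l ul]; exists l => n; apply/ler_addgt0Pr => e e0.
have /(cvgr_dist_lt _ _ ul)[k _ lk] : 0 < (e%:C)%C by rewrite ltcR.
have := lk (n + k)%N (leq_addl _ _).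
rewrite normE ltcR rdistC => /ltW luk.
by apply: le_trans (rdistD (u (n + k)%N) _ _) _; exact: lerD.
Qed.

(** * Continuity of the ternary product *)

Section TernaryProduct.
Variables (R : realType) (A : cstarTernaryType R).
Implicit Types (x y z : A) (a b c : R[i]).

Lemma rnorm_tprod x y z : rnorm (tprod x y z) <= rnorm x * rnorm y * rnorm z.
Proof. by rewrite -lecR !rmorphM /= -!normE; exact: norm_tprod_le. Qed.

Lemma tprodBl x x' y z : tprod (x - x') y z = tprod x y z - tprod x' y z.
Proof.
by have := tprod_linearl y z (-1) x' x; rewrite !scaleN1r /= ![- _ + _]addrC.
Qed.

Lemma tprodBm x y y' z : tprod x (y - y') z = tprod x y z - tprod x y' z.
Proof.
have := tprod_conj_linear (-1) x y' y z.
by rewrite rmorphN1 !scaleN1r ![- _ + _]addrC.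
Qed.

Lemma tprodBr x y z z' : tprod x y (z - z') = tprod x y z - tprod x y z'.
Proof.
by have := tprod_linearr x y (-1) z' z; rewrite !scaleN1r /= ![- _ + _]addrC.
Qed.

Lemma tprodZ a b c x y z :
  tprod (a *: x) (b *: y) (c *: z) = (a * b^* * c) *: tprod x y z.
Proof.
have t0 (w v : A) : tprod 0 w v = 0 by have := tprodBl 0 0 w v; rewrite !subrr.
have tm0 (w v : A) : tprod w 0 v = 0 by have := tprodBm w 0 0 v; rewrite !subrr.
have tr0 (w v : A) : tprod w v 0 = 0 by have := tprodBr w v 0 0; rewrite !subrr.
rewrite -[a *: x]addr0 tprod_linearl t0 addr0.
rewrite -[b *: y]addr0 tprod_conj_linear tm0 addr0.
by rewrite -[c *: z]addr0 tprod_linearr tr0 addr0 !scalerA.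
Qed.

(** The factors are replaced by their limits one at a time; each difference is controlled by
    submultiplicativity of the norm and boundedness of [v] and [w]. *)
Lemma geo_cvg_tprod (r : R) (u v w : nat -> A) x y z : 0 <= r < 1 ->
  geo_cvg r u x -> geo_cvg r v y -> geo_cvg r w z ->
  geo_cvg r (fun n => tprod (u n) (v n) (w n)) (tprod x y z).
Proof.
move=> r01 ux vy wz.
have [Mv Mv0 vM] := geo_cvg_bounded r01 vy.
have [Mw Mw0 wM] := geo_cvg_bounded r01 wz.
case: ux vy wz => [C uC] [D vD] [E wE].
exists (C * Mv * Mw + rnorm x * D * Mw + rnorm x * rnorm y * E) => n.
have -> : tprod (u n) (v n) (w n) - tprod x y z =
    tprod (u n - x) (v n) (w n) + tprod x (v n - y) (w n)
    + tprod x y (w n - z).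
  by rewrite tprodBl tprodBm tprodBr !subrKA.
rewrite !mulrDl; apply: le_trans (rnormD _ _) (lerD _ _).
  apply: le_trans (rnormD _ _) (lerD _ _).
    apply: le_trans (rnorm_tprod _ _ _) _.
    rewrite (_ : C * Mv * Mw * r ^+ n = C * r ^+ n * Mv * Mw); last by ring.
    by rewrite !ler_pM ?mulr_ge0 ?rnorm_ge0.
  apply: le_trans (rnorm_tprod _ _ _) _.
  rewrite (_ : _ * r ^+ n = rnorm x * (D * r ^+ n) * Mw); last by ring.
  by rewrite !ler_pM ?mulr_ge0 ?rnorm_ge0.
apply: le_trans (rnorm_tprod _ _ _) _.
by rewrite -[leRHS]mulrA ler_wpM2l// mulr_ge0 ?rnorm_ge0.
Qed.

End TernaryProduct.

(** * Rescaling by powers of three *)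

Lemma scaler_swap (K : comNzRingType) (V : lmodType K) (a b : K) (x : V) :
  a *: (b *: x) = b *: (a *: x).
Proof. by rewrite !scalerA mulrC. Qed.

Lemma powR_exp (R : realType) (a s : R) n : 0 <= a ->
  (a ^+ n) `^ s = (a `^ s) ^+ n.
Proof.
by move=> a0; rewrite -powR_mulrn// -powRrM mulrC powRrM powR_mulrn// powR_ge0.
Qed.

Lemma powR3_ratio (R : realType) (p : R) : p < 1 -> 0 <= 3 `^ p / 3 < 1.
Proof.
move=> p1; rewrite divr_ge0 ?powR_ge0//=.
rewrite -{2}[3]powRr1// -powRB ?pnatr_eq0 ?implybT//.
rewrite lt_neqAle powR_eq1 -[leRHS](powRr0 3) ler_powR ?ler1n ?subr_le0 ?(ltW p1)//
  andbT subr_eq0 (lt_eqF p1) orbF pnatr_eq1 /=.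
by rewrite ltNge ler0n.
Qed.

Definition rescale (R : realType) (A B : normedModType R[i]) (f : A -> B)
    (n : nat) (x : A) : B := 3 ^- n *: f (3 ^+ n *: x).

Section Rescaling.
Variables (R : realType) (A B : normedModType R[i]) (p : R) (f : A -> B).
Let r := 3 `^ p / 3.

(** This gives uniqueness: any such [h] is the pointwise limit of the rescalings of [f]. The error
    at [3 ^+ n *: x] grows like [3 ^ (n p)] and is divided by [3 ^ n]. *)
Lemma rescale_dist (K : R) (h : A -> B) :
  (forall n x, h (3 ^+ n *: x) = 3 ^+ n *: h x) ->
  (forall x, rnorm (h x - f x) <= K * norm_pow x p) ->
  forall n x, rnorm (rescale f n x - h x) <= K * norm_pow x p * r ^+ n.
Proof.
move=> hZ hK n x; have X0 : 3 ^+ n != 0 :> R[i].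
  by rewrite expf_neq0// pnatr_eq0.
have -> : h x = 3 ^- n *: h (3 ^+ n *: x) by rewrite hZ scalerA mulVf// scale1r.
rewrite -scalerBr (rnormZ _ (norm_natXV R 3 n)) rdistC.
apply: le_trans (ler_wpM2l _ (hK _)) _; first by rewrite invr_ge0 exprn_ge0.
rewrite (norm_powZ _ _ _ (norm_natX R 3 n)) ?exprn_gt0// powR_exp//.
by rewrite /r exprMn exprVn le_eqVlt; apply/orP; left; apply/eqP; ring.
Qed.

Lemma rescale_step (D : R) :
  (forall x, rnorm (f x - 3^-1 *: f (3 *: x)) <= D * norm_pow x p) ->
  forall n x, rnorm (rescale f n x - rescale f n.+1 x)
    <= D * norm_pow x p * r ^+ n.
Proof.
move=> fD n x; have -> : rescale f n x - rescale f n.+1 x =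
    3 ^- n *: (f (3 ^+ n *: x) - 3^-1 *: f (3 *: (3 ^+ n *: x))).
  by rewrite scalerBr !scalerA -exprS -invfM -exprSr.
rewrite (rnormZ _ (norm_natXV R 3 n)).
apply: le_trans (ler_wpM2l _ (fD _)) _; first by rewrite invr_ge0 exprn_ge0.
rewrite (norm_powZ _ _ _ (norm_natX R 3 n)) ?exprn_gt0// powR_exp//.
by rewrite /r exprMn exprVn le_eqVlt; apply/orP; left; apply/eqP; ring.
Qed.

End Rescaling.

(** * Existence and uniqueness of the homomorphism *)

Unset Implicit Arguments.

Theorem theorem3p2 (R : realType) (A B : cstarTernaryType R) (p theta : R)
    (p_ge0 : 0 <= p) (p_lt1 : p < 1) (theta_ge0 : 0 <= theta) (f : A -> B)
    (f_lin : forall (mu : R[i]) (x1 x2 x3 : A), `|mu| = 1 ->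
      rnorm (f (3^-1 *: (x2 - x1)) + f (3^-1 *: (x1 - (3 * mu) *: x3))
             + mu *: f (3^-1 *: (3 *: x1 + 3 *: x3 - x2)) - f x1)
        <= theta * (norm_pow x1 p + norm_pow x2 p + norm_pow x3 p))
    (f_tprod : forall x1 x2 x3 : A,
      rnorm (f (tprod x1 x2 x3) - tprod (f x1) (f x2) (f x3))
        <= theta * (norm_pow x1 (3 * p) + norm_pow x2 (3 * p)
                    + norm_pow x3 (3 * p))) :
  exists! H : A -> B, cstar_ternary_hom H /\
    forall x1 : A, rnorm (H x1 - f x1)
      <= theta * (1 + 2 `^ p) * norm_pow x1 p / (3 `^ (1 - p) - 1).
Proof.
set q : R := 3 `^ p; set r : R := q / 3.
have r01 : 0 <= r < 1 := powR3_ratio p_lt1.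
have [r0 r1] := andP r01.
have q0 : 0 < q by rewrite powR_gt0.
have q3 : q < 3 by move: r1; rewrite /r; lra.
set K := theta * (1 + 2 `^ p) / (3 `^ (1 - p) - 1).
(* Since [3 ^ (1 - p) = 1 / r], the constant of the stability bound is the sum of a geometric series
   with first term [theta * (1 + 2 ^ p) * r]. *)
have KE : K = theta * (1 + 2 `^ p) * r / (1 - r).
  rewrite /K powRB ?pnatr_eq0 ?implybT// powRr1// -/q -(mulrA _ r).
  congr (_ * _); rewrite /r; field.
  by rewrite subr_eq0 gt_eqF// gt_eqF.
have n3 : 3 != 0 :> R[i] by rewrite pnatr_eq0.
(* At the origin the right-hand side vanishes, even for [p = 0] by the convention of [norm_pow],
   leaving [2 f(0) = 0]. *)
have f0 : f 0 = 0.
  have := f_lin 1 0 0 0 (normr1 _).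
  rewrite !scaler0 !(subr0, addr0) !scaler0 norm_pow0 !addr0 mulr0 scale1r.
  rewrite addrK => /rnorm_le0/eqP; rewrite -mulr2n -scaler_nat scaler_eq0.
  by rewrite pnatr_eq0 => /eqP.
have f3 x : rnorm (f x - 3^-1 *: f (3 *: x))
    <= theta * (1 + 2 `^ p) * r * norm_pow x p.
  (* With these values all three inner arguments equal [x], so the defect is [3 f(x) - f(3x)]. *)
  have := f_lin 1 (3 *: x) (2 *: (3 *: x)) 0 (normr1 _).
  rewrite norm_pow0 !scaler0 !(subr0, addr0) scale1r.
  rewrite -{2}[3 *: x]scale1r -!scalerBl !scalerA.
  rewrite (_ : 2 - 1 = 1); last by ring.
  rewrite (_ : 3 - 2 = 1); last by ring.
  rewrite mulr1 mulVf// !scale1r.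
  have nn m : (0 < m)%N -> forall y : A,
      norm_pow (m%:R *: y) p = m%:R `^ p * norm_pow y p.
    move=> m0 y; rewrite (norm_powZ (c := m%:R)) ?ltr0n//.
    by rewrite normr_nat rmorph_nat.
  rewrite -scalerA !nn// -/q => h.
  have -> : f x - 3^-1 *: f (3 *: x) = 3^-1 *: (f x + f x + f x - f (3 *: x)).
    rewrite scalerBr; congr (_ - _); rewrite -[f x in RHS]scale1r -!scalerDl.
    by rewrite scalerA (_ : 3^-1 * _ = 1) ?scale1r//; field.
  rewrite (rnormZ (c := 3^-1)); last by have := norm_natXV R 3 1; rewrite !expr1.
  apply: le_trans (ler_wpM2l _ h) _; first by rewrite invr_ge0.
  by rewrite /r le_eqVlt; apply/orP; left; apply/eqP; field.
have lim_ex x : exists l,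
    forall n, rnorm (rescale f n x - l) <= K * norm_pow x p * r ^+ n.
  apply: geo_cauchy_cvg => // n; apply: le_trans (rescale_step f3 n x) _.
  by rewrite -/q -/r KE le_eqVlt; apply/orP; left; apply/eqP; field; lra.
have [H HK] := choice lim_ex.
have Hcvg x : geo_cvg r (rescale f ^~ x) (H x) by exists (K * norm_pow x p).
have H_lin mu x1 x2 x3 : `|mu| = 1 ->
    H (3^-1 *: (x2 - x1)) + H (3^-1 *: (x1 - (3 * mu) *: x3))
    + mu *: H (3^-1 *: (3 *: x1 + 3 *: x3 - x2)) = H x1.
  move=> mu1; apply/eqP; rewrite -subr_eq0; apply/eqP.
  set y1 := 3^-1 *: (x2 - x1); set y2 := 3^-1 *: (x1 - _).
  set y3 := 3^-1 *: (_ - x2).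
  (* The defect of the rescaled maps tends to that of [H]; it also tends to 0, being the defect of
     [f] at the points [3 ^+ n *: xi] divided by [3 ^ n]. *)
  have lim := geo_cvgB (geo_cvgD
    (geo_cvgD (Hcvg y1) (Hcvg y2)) (geo_cvgZ mu (Hcvg y3))) (Hcvg x1).
  apply: (geo_cvg_unique r01 lim).
  exists (theta * (norm_pow x1 p + norm_pow x2 p + norm_pow x3 p)) => n.
  rewrite subr0 /rescale [mu *: _]scaler_swap -!scalerDr -scalerBr.
  rewrite (rnormZ _ (norm_natXV R 3 n)).
  have := f_lin mu (3 ^+ n *: x1) (3 ^+ n *: x2) (3 ^+ n *: x3) mu1.
  rewrite !(norm_powZ _ _ _ (norm_natX R 3 n)) ?exprn_gt0// powR_exp// -/q.
  rewrite !(scaler_swap _ (3 ^+ n)) -(scalerDr (3 ^+ n : R[i])).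
  rewrite -!(scalerBr (3 ^+ n : R[i])) !(scaler_swap _ (3 ^+ n)) => h.
  apply: le_trans (ler_wpM2l _ h) _; first by rewrite invr_ge0 exprn_ge0.
  by rewrite /r exprMn exprVn le_eqVlt; apply/orP; left; apply/eqP; ring.
have HD x y : H (x + y) = H x + H y.
  have H0 : H 0 = 0.
    apply: (geo_cvg_unique r01 (Hcvg 0)); exists 0 => n.
    by rewrite /rescale scaler0 f0 scaler0 subrr rnorm0 mul0r.
  have two_y : 3 *: y - 2 *: y = y.
    by rewrite -scalerBl (_ : 3 - 2 = 1) ?scale1r//; ring.
  (* Chosen so that the three inner arguments become [x], [y] and 0, while the right-hand side is
     [H (x + y)]. *)
  have := H_lin 1 (x + y) (3 *: x + (x + y)) (3^-1 *: (x - 2 *: y)) (normr1 _).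
  rewrite addrK mulr1 scalerA mulVf// scale1r !scalerA mulfV// !scale1r.
  have -> : x + y - (x - 2 *: y) = 3 *: y.
    by rewrite opprB [x + y]addrC addrACA subrr addr0 -{1}two_y subrK.
  have -> : 3 *: (x + y) + (x - 2 *: y) - (3 *: x + (x + y)) = 0.
    by apply/eqP; rewrite subr_eq0 scalerDr addrACA two_y addrA.
  by rewrite scaler0 H0 addr0 scalerK.
have HZ mu x : `|mu| = 1 -> H (mu *: x) = mu *: H x.
  move=> mu1; have H0 : H 0 = 0 by apply: (addrI (H 0)); rewrite -HD !addr0.
  (* This reads [H (- (mu *: x)) + mu *: H x = 0]; additivity makes [H] odd, which removes the
     sign. *)
  have := H_lin mu 0 0 x mu1.
  rewrite !subr0 !scaler0 sub0r !add0r H0 add0r scalerN -scalerA !scalerK//.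
  move=> /eqP; rewrite addrC addr_eq0 => /eqP ->.
  by apply/eqP; rewrite -addr_eq0 -HD subrr H0.
have Hlin : linear H := linear_of_unit_circle HD HZ.
have H_tprod x y z : H (tprod x y z) = tprod (H x) (H y) (H z).
  have lim := geo_cvg_tprod r01 (Hcvg x) (Hcvg y) (Hcvg z).
  apply: (geo_cvg_unique r01 _ lim).
  (* Scaling each factor by [3 ^ n] scales the product by [3 ^ (3 n)], so the comparison uses every
     third rescaling; [r ^ (3 n) <= r ^ n] keeps the rate. *)
  have lim3 : geo_cvg r (fun n => rescale f (3 * n) (tprod x y z))
      (H (tprod x y z)).
    exists (K * norm_pow (tprod x y z) p) => n; apply: le_trans (HK _ _) _.
    rewrite ler_wpM2l ?ler_wiXn2l ?leq_pmull ?(ltW r1)//.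
    by have := le_trans (rnorm_ge0 _) (HK (tprod x y z) 0); rewrite mulr1.
  set N := norm_pow x (3 * p) + norm_pow y (3 * p) + norm_pow z (3 * p).
  have N0 : 0 <= N by rewrite !addr_ge0 ?norm_pow_ge0.
  apply: (geo_cvg_perturb (C := theta * N) lim3) => n.
  have f3n := f_tprod (3 ^+ n *: x) (3 ^+ n *: y) (3 ^+ n *: z).
  have conj3 : (3 ^+ n : R[i])^* = 3 ^+ n by rewrite rmorphXn /= conjC_nat.
  have cube3 : 3 ^+ n * 3 ^+ n * 3 ^+ n = 3 ^+ (3 * n) :> R[i].
    by rewrite -!exprD !mulSn mul0n addn0 addnA.
  rewrite !tprodZ conj3 cube3 in f3n.
  rewrite /rescale !tprodZ fmorphV /= conj3 -!invfM cube3.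
  rewrite rdistC -scalerBr (rnormZ _ (norm_natXV R 3 _)).
  apply: le_trans (ler_wpM2l _ f3n) _; first by rewrite invr_ge0 exprn_ge0.
  rewrite !(norm_powZ _ _ _ (norm_natX R 3 n)) ?exprn_gt0// powR_exp//.
  (* The exponent [3 p] turns the growth factor into [q ^ (3 n)], which against [3 ^ (3 n)] leaves
     [r ^ (3 n)]. *)
  rewrite [3 * p]mulrC powRrM powR_mulrn ?powR_ge0// -/q -!mulrDr.
  rewrite [p * 3]mulrC -/N -exprM.
  rewrite (_ : _ ^-1 * _ = theta * N * r ^+ (3 * n)); last first.
    by rewrite /r [in RHS]exprMn exprVn; ring.
  by rewrite ler_wpM2l ?mulr_ge0// ler_wiXn2l ?leq_pmull ?(ltW r1).
exists H; split => [|H' [[H'lin _] H'K]].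
  split=> // x; rewrite rdistC.
  (* The rescaling of index 0 is [f] itself. *)
  have := HK x 0; rewrite /rescale expr0 invr1 !scale1r mulr1.
  by rewrite /K mulrAC.
(* A competitor [H'] commutes with powers of three by linearity, so it is a limit of the same
   sequence. *)
apply: funext => x; apply: (geo_cvg_unique r01 (Hcvg x)).
exists (K * norm_pow x p) => n.
apply: (rescale_dist (h := H')) => [m y|y]; last first.
  by rewrite /K mulrAC; exact: H'K.
have H'0 : H' 0 = 0.
  by have := H'lin (-1) 0 0; rewrite scaler0 addr0 scaleN1r addNr.
by have := H'lin (3 ^+ m) y 0; rewrite H'0 !addr0.
Qed.
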